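(* For every positive integer $n$, \[ \mathrm{Comp}_{n+1}(A_n) = (S_{\Omega_{n+1}} \cap A_{n+1}) \cup (X_{n+1} \cap (S_{n+1}\setminus A_{n+1})). \]
   Context: $S_n$ is the symmetric group on $[n]=\{1,\dots,n\}$ and $A_n$ the alternating group. $\Omega_{n}$ denotes the partition of $[n]$ into the set of odd numbers and the set of even numbers; $S_{\Omega_n}$ is the set of $\pi\in S_n$ mapping each block of $\Omega_n$ onto itself (i.e. $\pi(i)\equiv i \pmod 2$ for all $i$), and $X_n$ is the set of $\pi\in S_n$ interchanging the two blocks, i.e. $\pi(i)$ is odd iff $i$ is even, for all $i\in[n]$ (empty if $n$ is odd). A permutation $\pi\in S_m$ involves $\tau\in S_n$ ($n\le m$) if there are indices $i_1<\dots<i_n$ with $\pi(i_j)<\pi(i_k)$ iff $\tau(j)<\tau(k)$ for all $j,k$; such $\tau$ is an $n$-pattern of $\pi$. For $S\subseteq S_n$, $\mathrm{Comp}_m(S)$ is the set of all $\tau\in S_m$ all of whose $n$-patterns belong to $S$. *)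

(* Defs.v *)
From mathcomp Require Import all_boot all_fingroup all_solvable.

Set Implicit Arguments.
Unset Strict Implicit.
Unset Printing Implicit Defensive.

(* The set [n] = {1, ..., n} is represented by 'I_n, the number k in [n] being
   the ordinal of value k - 1. Hence the number represented by i : 'I_n is
   i.+1, and its parity is odd i.+1. *)

Definition odd_block (n : nat) : {set 'I_n} := [set i : 'I_n | odd i.+1].

Definition even_block (n : nat) : {set 'I_n} := [set i : 'I_n | ~~ odd i.+1].

(* For n = 1 the even block is empty; both definitions below still agree with
   their pointwise descriptions in terms of parity. *)
Definition Omega (n : nat) : {set {set 'I_n}} :=
  [set odd_block n; even_block n].

Definition S_Omega (n : nat) : {set 'S_n} :=
  [set s : 'S_n | [forall B in Omega n, s @: B == B]].

Definition X (n : nat) : {set 'S_n} :=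
  [set s : 'S_n | (s @: odd_block n == even_block n) &&
                  (s @: even_block n == odd_block n)].

(* No hypothesis n <= m is needed: a strictly increasing f : 'I_n -> 'I_m
   exists only if n <= m. *)
Definition involves (m n : nat) (p : 'S_m) (t : 'S_n) : bool :=
  [exists f : {ffun 'I_n -> 'I_m},
     [forall j : 'I_n, forall k : 'I_n, (j < k) ==> (f j < f k)] &&
     [forall j : 'I_n, forall k : 'I_n, (p (f j) < p (f k)) == (t j < t k)]].

Definition Comp (n m : nat) (S : {set 'S_n}) : {set 'S_m} :=
  [set p : 'S_m | [forall t : 'S_n, involves p t ==> (t \in S)]].
Arguments Comp {n} m S.

(* Main.v *)
Require Import Defs.
From mathcomp Require Import all_boot all_fingroup all_solvable.

(** An [n]-pattern of [p] in [S_(n+1)] is what remains after deleting one entry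
    [(i, p i)], and the sign of the remaining permutation is the sign of [p]
    times [(-1)^(i + p i)]. Hence all [n]-patterns of [p] are even iff
    [i + p i] has the parity of [p] for every [i]. *)

Lemma leq_increasing (n : nat) (g : 'I_n -> 'I_n) :
  {homo g : j k / j < k} -> forall i : 'I_n, i <= g i.
Proof.
move=> g_incr [i lt_in]; elim: i lt_in => [//|i IHi] lt_in /=.
have lt_in' := ltnW lt_in.
exact: leq_ltn_trans (IHi lt_in') (g_incr (Ordinal lt_in') (Ordinal lt_in) _).
Qed.

(* Conjugating by the order reversal turns [i <= g i] into [g i <= i]. *)
Lemma increasing_id (n : nat) (g : 'I_n -> 'I_n) :
  {homo g : j k / j < k} -> g =1 id.
Proof.
move=> g_incr i; apply/val_inj/eqP; rewrite eqn_leq (leq_increasing _ _ g_incr) andbT.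
have rev_lt (j k : 'I_n) : (rev_ord j < rev_ord k) = (k < j).
  by rewrite /= ltn_sub2lE.
have h_incr : {homo (fun j => rev_ord (g (rev_ord j))) : j k / j < k}.
  by move=> j k lt_jk; rewrite rev_lt g_incr // rev_lt.
have := leq_increasing _ _ h_incr (rev_ord i).
by rewrite rev_ordK leqNgt rev_lt -leqNgt.
Qed.

Lemma ltn_lift (n : nat) (h : 'I_n.+1) (j k : 'I_n) :
  (lift h j < lift h k) = (j < k).
Proof. by rewrite !ltnNge leq_bump2. Qed.

(** Deleting the entry [(i, p i)] and closing the gaps in positions and values leaves the
    permutation [t]. *)
Lemma lift_perm_exists (n : nat) (p : 'S_n.+1) (i : 'I_n.+1) :
  exists t : 'S_n, p = lift_perm i (p i) t.
Proof.
(* The default [k] is never taken: [p (lift i k) = p i] would force [lift i k = i]. *)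
pose g (k : 'I_n) := odflt k (unlift (p i) (p (lift i k))).
have gE k : lift (p i) (g k) = p (lift i k).
  rewrite /g; case: unliftP => [j -> //|/perm_inj/esym/eqP].
  by rewrite (negPf (neq_lift _ _)).
have g_inj : injective g.
  by move=> j k eq_g; apply/(@lift_inj _ i)/(@perm_inj _ p); rewrite -!gE eq_g.
exists (perm g_inj); apply/permP => j.
by case: (unliftP i j) => [k|] ->; rewrite ?lift_perm_id // lift_perm_lift permE gE.
Qed.

Lemma involves_lift_perm (n : nat) (i j : 'I_n.+1) (t : 'S_n) :
  involves (lift_perm i j t) t.
Proof.
apply/existsP; exists [ffun k => lift i k]; apply/andP.
split; apply/forallP => a; apply/forallP => b; rewrite !ffunE.
  by rewrite ltn_lift implybb.
by rewrite !lift_perm_lift ltn_lift.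
Qed.

(** By cardinality [f] misses some [i]; closing the gap at [i] makes [f] an increasing self-map of
    ['I_n], hence the identity. *)
Lemma increasing_lift (n : nat) (f : 'I_n -> 'I_n.+1) :
  {homo f : j k / j < k} -> exists i : 'I_n.+1, f =1 lift i.
Proof.
move=> f_incr.
have [i fNi] : exists i, i \notin codom f.
  apply/existsP; rewrite -negb_forall; apply/negP => /forallP f_onto.
  have := leq_image_card f predT.
  have -> : #|codom f| = n.+1.
    by rewrite -[RHS]card_ord; apply: eq_card => i; rewrite f_onto.
  by rewrite card_ord ltnn.
exists i => k.
pose g k := odflt k (unlift i (f k)).
have gE j : lift i (g j) = f j.
  rewrite /g; case: unliftP => [j' -> //|fj].
  by rewrite -fj codom_f in fNi.
rewrite -gE increasing_id // => a b lt_ab.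
by rewrite -(ltn_lift _ i) !gE f_incr.
Qed.

(** An embedding skips exactly one position [i], so the pattern it selects is the one left by
    deleting the entry at [i]. *)
Lemma involvesP (n : nat) (p : 'S_n.+1) (t : 'S_n) :
  reflect (exists i, p = lift_perm i (p i) t) (involves p t).
Proof.
apply: (iffP idP) => [|[i ->]]; last exact: involves_lift_perm.
case/existsP => f /andP[/forallP f_incr /forallP ft].
have [i fE] : exists i : 'I_n.+1, f =1 lift i.
  by apply: increasing_lift => j k; apply/implyP/(forallP (f_incr j)).
have [u pE] := lift_perm_exists _ p i.
have ut j k : (u j < u k) = (t j < t k).
  have /eqP := forallP (ft j) k.
  by rewrite !fE pE !lift_perm_lift ltn_lift.
exists i; rewrite [LHS]pE; congr lift_perm; apply/permP => k.
(* As [u] and [t] order all pairs of positions alike, [u] after the inverse of [t] is increasing,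
   hence the identity. *)
rewrite -[k](permK t) permKV -[RHS](increasing_id _ (fun j => u (t^-1%g j))) //.
by move=> a b; rewrite ut !permKV.
Qed.

Lemma mem_Comp_Alt (n : nat) (p : 'S_n.+1) :
  (p \in Comp n.+1 ('Alt_('I_n))%g)
  = [forall i, odd (p i) == odd i (+) odd_perm p].
Proof.
have oddE i t : p = lift_perm i (p i) t ->
    (t \in ('Alt_('I_n))%g) = (odd (p i) == odd i (+) odd_perm p).
  (* By [odd_lift_perm], the parity of [p] is the sum of those of [i], [p i] and [t]. *)
  move=> pE; rewrite Alt_even [in odd_perm p]pE odd_lift_perm.
  by case: (odd_perm t); case: (odd i); case: (odd _).
rewrite inE; apply/forallP/forallP => [pA i | p_odd t].
  have [t pE] := lift_perm_exists _ p i.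
  by rewrite -(oddE _ t) //; apply: (implyP (pA t)); apply/involvesP; exists i.
by apply/implyP => /involvesP[i pE]; rewrite (oddE i).
Qed.

Lemma imset_perm_eq (T : finType) (s : {perm T}) (A B : {set T}) :
  (s @: A == B) = [forall x, (s x \in B) == (x \in A)].
Proof.
apply/eqP/forallP => [<- x | sAB].
  by rewrite mem_imset //; exact: perm_inj.
apply/setP => y; rewrite -(permKV s y) mem_imset; last exact: perm_inj.
exact/esym/eqP.
Qed.

Lemma mem_S_Omega (n : nat) (s : 'S_n) :
  (s \in S_Omega n) = [forall i, odd (s i) == odd i].
Proof.
rewrite inE; apply/forall_inP/forallP => [sO i | s_odd B].
  (* Lying in the odd block determines the parity of a point; the shift [i.+1] negates both sides
     and cancels. *)
  have := sO (odd_block n); rewrite !inE eqxx => /(_ isT).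
  by rewrite imset_perm_eq => /forallP/(_ i); rewrite !inE /= (inj_eq negb_inj).
rewrite imset_perm_eq => B_O; apply/forallP => i; have /eqP s_i := s_odd i.
by move: B_O; rewrite !inE => /orP[] /eqP->; rewrite !inE /= s_i.
Qed.

Lemma mem_X (n : nat) (s : 'S_n) :
  (s \in X n) = [forall i, odd (s i) == ~~ odd i].
Proof.
rewrite inE !imset_perm_eq; apply/andP/forallP => [[/forallP sX _] i | s_odd].
  by have := sX i; rewrite !inE /= negbK.
by split; apply/forallP => i; rewrite !inE /= (eqP (s_odd i)) !negbK.
Qed.

Theorem theorem4p4 (n : nat) (hn : 0 < n) :
  Comp n.+1 ('Alt_('I_n))%g =
    (S_Omega n.+1 :&: ('Alt_('I_n.+1))%g)
    :|: (X n.+1 :&: ([set: 'S_n.+1] :\: ('Alt_('I_n.+1))%g)).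
Proof.
apply/setP => p; rewrite mem_Comp_Alt in_setU in_setI Alt_even.
rewrite in_setI in_setD in_setT Alt_even mem_S_Omega mem_X.
(* The sign of [p] selects one member of the union: parity is preserved for even [p] and reversed
   for odd [p]. *)
case: (odd_perm p); rewrite /= ?andbF ?andbT ?orbF;
  by apply: eq_forallb => i; rewrite ?addbT ?addbF.
Qed.
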